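(* Let $(X,Q,\pi)$ be a finite Markov chain satisfying $CD_{ent}(0,\infty)$. Then $$\lambda_1(X)\,\tau_{\rm avg}(1/4)\le\frac{256\log(2)}{(Q_{\min})^2},$$ where $\lambda_1(X)$ is the smallest positive eigenvalue of $-\Delta$ and $Q_{\min}=\min_{x\sim y}Q(x,y)$.
   Context: A finite Markov chain $(X,Q,\pi)$ is always assumed irreducible and reversible: $X$ is a finite set, $Q:X\times X\to[0,1]$ satisfies $\sum_{y}Q(x,y)=1$ for all $x$ and is irreducible, $\pi\in(0,1]^X$ is the unique stationary probability measure, and $Q(x,y)\pi(x)=Q(y,x)\pi(y)$ for all $x,y$. Write $x\sim y$ if $x\ne y$ and $Q(x,y)>0$. For $f,g\in\mathbb{R}^X$ put $\langle f,g\rangle_\pi=\sum_{x}f(x)g(x)\pi(x)$ and $\Delta f(x)=\sum_{y}(f(y)-f(x))Q(x,y)$. $P_t=e^{t\Delta}$ is the heat semigroup. The logarithmic mean is $\theta_{log}(r,s)=\int_0^1r^{1-p}s^p\,dp$, and $\partial_1\theta_{log}(r,s)=\frac{\partial}{\partial r}\theta_{log}(r,s)$ for $r,s>0$. For $\rho\in(0,\infty)^X$ define $\Delta_\rho f(x)=\sum_{y}2\,\partial_1\theta_{log}(\rho(x),\rho(y))(f(y)-f(x))Q(x,y)$, $2\Gamma_\rho(f,g)=\Delta_\rho(fg)-f\Delta_\rho g-g\Delta_\rho f$, $2\Gamma_{2,\rho}(f,g)=\Delta\Gamma_\rho(f,g)-\Gamma_\rho(f,\Delta g)-\Gamma_\rho(g,\Delta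 f)$, and $\Gamma_{2,\rho}f=\Gamma_{2,\rho}(f,f)$. $X$ satisfies $CD_{ent}(0,\infty)$ if $\langle\rho,\Gamma_{2,\rho}f\rangle_\pi\ge0$ for all $\rho\in(0,\infty)^X$ and all $f\in\mathbb{R}^X$. The heat kernel is $p_t(x,y)=\frac1{\pi(x)}(P_t\mathbf{1}_x)(y)$, where $\mathbf{1}_x$ is the indicator function of $\{x\}$. The average mixing time is $\tau_{\rm avg}(\varepsilon)=\inf\{t>0:\sum_{x,y\in X}\pi(x)\pi(y)|p_t(x,y)-1|\le\varepsilon\}$. *)

(* Defs.v *)
From mathcomp Require Import all_boot all_order all_algebra.
From mathcomp Require Import all_classical all_reals all_analysis.

Set Implicit Arguments.
Unset Strict Implicit.
Unset Printing Implicit Defensive.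

Import Order.TTheory GRing.Theory Num.Theory.
Import numFieldNormedType.Exports.

Local Open Scope classical_set_scope.
Local Open Scope ring_scope.

(* Uniqueness of the stationary probability measure is not a field: it follows
   from irreducibility. *)
Record markov_chain (R : realType) (X : finType) (Q : X -> X -> R)
    (pi : X -> R) : Prop := MarkovChain {
  chain_Q01 : forall x y, 0 <= Q x y <= 1;
  chain_Q_sum : forall x, \sum_(y : X) Q x y = 1;
  chain_irreducible : forall x y, connect (fun u v => 0 < Q u v) x y;
  chain_pi01 : forall x, 0 < pi x <= 1;
  chain_pi_sum : \sum_(x : X) pi x = 1;
  chain_stationary : forall y, \sum_(x : X) pi x * Q x y = pi y;
  chain_reversible : forall x y, Q x y * pi x = Q y x * pi y
}.

Definition adjacent (R : realType) (X : finType) (Q : X -> X -> R) : rel X :=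
  fun x y => (x != y) && (0 < Q x y).

(* The default value 1 of the iterated minimum does not affect the result when
   some pair is adjacent, because Q x y <= 1. *)
Definition Qmin (R : realType) (X : finType) (Q : X -> X -> R) : R :=
  \big[Num.min/1]_(e : X * X | adjacent Q e.1 e.2) Q e.1 e.2.

Definition inner (R : realType) (X : finType) (pi f g : X -> R) : R :=
  \sum_(x : X) f x * g x * pi x.

Definition laplacian (R : realType) (X : finType) (Q : X -> X -> R)
    (f : X -> R) : X -> R :=
  fun x => \sum_(y : X) (f y - f x) * Q x y.

Definition eigenvalue_neg_laplacian (R : realType) (X : finType)
    (Q : X -> X -> R) (lam : R) : Prop :=
  exists2 f : X -> R,
    (exists x, f x != 0) & forall x, - laplacian Q f x = lam * f x.

Definition smallest_positive_eigenvalue (R : realType) (X : finType)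
    (Q : X -> X -> R) (lam : R) : Prop :=
  [/\ 0 < lam, eigenvalue_neg_laplacian Q lam &
      forall lam', 0 < lam' -> eigenvalue_neg_laplacian Q lam' -> lam <= lam'].

(* The exponential series of t * laplacian, applied to f at x; it converges
   because X is finite. *)
Definition heat (R : realType) (X : finType) (Q : X -> X -> R) (t : R)
    (f : X -> R) : X -> R :=
  fun x => limn (series (fun n : nat => t ^+ n / n`!%:R * iter n (laplacian Q) f x)).

Definition heat_kernel (R : realType) (X : finType) (Q : X -> X -> R)
    (pi : X -> R) (t : R) (x y : X) : R :=
  (pi x)^-1 * heat Q t (fun z => (z == x)%:R) y.

(* Extended-real infimum, so that the infimum of the empty set is +oo. *)
Definition tau_avg (R : realType) (X : finType) (Q : X -> X -> R)
    (pi : X -> R) (eps : R) : \bar R :=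
  ereal_inf [set t%:E | t in [set t : R | 0 < t /\
    \sum_(x : X) \sum_(y : X) pi x * pi y * `|heat_kernel Q pi t x y - 1|
      <= eps]].

Definition theta_log (R : realType) (r s : R) : R :=
  \int[@lebesgue_measure R]_(p in `[0, 1]) (r `^ (1 - p) * s `^ p).

Definition d1_theta_log (R : realType) (r s : R) : R :=
  derive1 (fun u : R => theta_log u s) r.

Definition laplacian_rho (R : realType) (X : finType) (Q : X -> X -> R)
    (rho f : X -> R) : X -> R :=
  fun x => \sum_(y : X)
    2 * d1_theta_log (rho x) (rho y) * (f y - f x) * Q x y.

Definition Gamma_rho (R : realType) (X : finType) (Q : X -> X -> R)
    (rho f g : X -> R) : X -> R :=
  fun x => (laplacian_rho Q rho (fun z => f z * g z) x
            - f x * laplacian_rho Q rho g x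
            - g x * laplacian_rho Q rho f x) / 2.

Definition Gamma2_rho (R : realType) (X : finType) (Q : X -> X -> R)
    (rho f g : X -> R) : X -> R :=
  fun x => (laplacian Q (Gamma_rho Q rho f g) x
            - Gamma_rho Q rho f (laplacian Q g) x
            - Gamma_rho Q rho g (laplacian Q f) x) / 2.

Definition CD_ent_0_oo (R : realType) (X : finType) (Q : X -> X -> R)
    (pi : X -> R) : Prop :=
  forall rho f : X -> R, (forall x, 0 < rho x) ->
    0 <= inner pi rho (Gamma2_rho Q rho f f).

(* Main.v *)
Require Import Defs.
From mathcomp Require Import all_boot all_order all_algebra.
From mathcomp Require Import all_classical all_reals all_analysis.
From mathcomp Require Import ring lra.

Import Order.TTheory GRing.Theory Num.Theory.
Import numFieldNormedType.Exports.
Local Open Scope ring_scope.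

(** The curvature condition makes the heat flow smooth functions at a rate that
    depends only on $Q_{\min}$; combined with the spectral gap, this gives an
    isoperimetric inequality, by which the heat kernel, being smooth itself, must
    be nearly constant.

    Write $A(\rho,f) = \frac12\sum_{x,y} \theta_{log}(\rho(x),\rho(y))
    (f(y)-f(x))^2 Q(x,y)\pi(x)$. Along $s \mapsto A(P_s\rho, P_{t-s}f)$ the
    derivative is $2\langle P_s\rho, \Gamma_{2,P_s\rho}P_{t-s}f\rangle_\pi$, so
    this quantity increases ([action_heat_le]). Comparing it with the derivative
    of $\langle P_s\rho, (P_{t-s}f)^2\rangle_\pi$ gives the reverse Poincare
    inequality $t A(\rho,P_tf) \le \langle P_t\rho, f^2\rangle_\pi$
    ([reverse_poincare]). Letting $\rho$ concentrate on the two ends of an edge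
    turns it into a pointwise bound: $P_tf$ varies along every edge by at most
    $\kappa/\sqrt t$ with $\kappa = \sqrt{2/Q_{\min}}$, whenever $|f| \le 1$
    ([heat_edge]).

    This bound is used twice. Let $V(g) = \frac12\sum_{x,y}|g(y)-g(x)|
    Q(x,y)\pi(x)$.

    (1) For a set $B$ with indicator $g$ it shows that the passage from $g$ to
    $P_sg$ loses at most $\kappa V(g)\sqrt s$ of the variance, in the sense of
    $\langle g-\bar g, g - P_sg\rangle_\pi$, where $\bar g$ is the mean of $g$
    ([smoothing]). At time $s = \ln 2/\lambda_1$ the spectral gap forces a loss of
    half the variance ([heat_decay]). Hence $\|g-\bar g\|_1 \le
    4\kappa\sqrt{\ln 2/\lambda_1}\,V(g)$, first for indicators
    ([deviation_indicator]) and then, by the co-area principle, for all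
    nonnegative $g$ ([deviation_le_variation]).

    (2) By duality with functions of sup norm 1, the average over $x$ of
    $V(p_t(x,\cdot))$ is at most $\kappa/(2\sqrt t)$ ([variation_heat_kernel]).

    Applying (1) to $g = p_t(x,\cdot)$ and averaging, the quantity in the
    definition of $\tau_{avg}$ is at most $\frac{4}{Q_{\min}}
    \sqrt{\ln 2/(\lambda_1 t)}$, which equals $\frac14$ for
    $t = 256\ln 2/(\lambda_1Q_{\min}^2)$ ([mixing_bound]). *)

(** * Calculus of real functions *)

Section RealCalculus.
Context {R : realType}.
Implicit Types (f g : R -> R) (t a b c : R).

Lemma rderive_mul {f g t a b} : is_derive t 1 f a -> is_derive t 1 g b ->
  is_derive t 1 (fun s => f s * g s) (a * g t + f t * b).
Proof.
move=> df dg; apply: is_derive_eq (is_deriveM df dg) _.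
by rewrite /GRing.scale /= addrC [a * _]mulrC.
Qed.

Lemma rderive_mulr {f t a} c : is_derive t 1 f a ->
  is_derive t 1 (fun s => f s * c) (a * c).
Proof.
by move=> df; apply: is_derive_eq (rderive_mul df (is_derive_cst c t 1)) _;
  rewrite mulr0 addr0.
Qed.

Lemma rderive_mull {f t a} c : is_derive t 1 f a ->
  is_derive t 1 (fun s => c * f s) (c * a).
Proof.
by move=> df; apply: is_derive_eq (rderive_mul (is_derive_cst c t 1) df) _;
  rewrite mul0r add0r.
Qed.

Lemma rderive_comp {f g t a b} : is_derive (g t) 1 f a -> is_derive t 1 g b ->
  is_derive t 1 (fun s => f (g s)) (a * b).
Proof. by move=> df dg; exact: is_derive1_comp. Qed.

Lemma rderive_opp {f t a} : is_derive t 1 f a ->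
  is_derive t 1 (fun s => - f s) (- a).
Proof. by move=> df; exact: is_deriveN. Qed.

Lemma rderive_sub {f g t a b} : is_derive t 1 f a -> is_derive t 1 g b ->
  is_derive t 1 (fun s => f s - g s) (a - b).
Proof. by move=> df dg; exact: is_deriveB. Qed.

Lemma rderive_id t : is_derive t 1 (fun s : R => s) 1.
Proof. exact: is_derive_id. Qed.

Lemma rderive_rev {f t c a} : is_derive (c - t) 1 f a ->
  is_derive t 1 (fun s => f (c - s)) (- a).
Proof.
move=> df; have dg := rderive_sub (is_derive_cst c t 1) (rderive_id t).
by apply: is_derive_eq (rderive_comp (g := fun s => c - s) df dg) _; rewrite sub0r mulrN1.
Qed.

Lemma rderive_sum (X : finType) (F : X -> R -> R) (dF : X -> R) t :
  (forall x, is_derive t 1 (F x) (dF x)) ->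
  is_derive t 1 (fun s => \sum_x F x s) (\sum_x dF x).
Proof.
move=> dFx; rewrite (_ : (fun s => _) = \sum_x F x); last first.
  by apply/funext => s; rewrite fct_sumE.
by elim/big_ind2 : _ => // [|] *; [exact: is_derive_cst|exact: is_deriveD].
Qed.

Lemma rderive_continuous {f t a} : is_derive t 1 f a -> {for t, continuous f}.
Proof. by case=> df _; apply/differentiable_continuous/derivable1_diffP. Qed.

(** The mean value inequality, in the form in which every monotonicity argument
    below uses it. *)
Lemma rderive_growth f (df : R -> R) a b c : a <= b ->
  (forall t, a <= t <= b -> is_derive t 1 f (df t)) ->
  (forall t, a <= t <= b -> c <= df t) ->
  c * (b - a) <= f b - f a.
Proof.
move=> ab dfP cdf.
have [||t] := @MVT_segment R f df a b ab.
- by move=> t; rewrite in_itv/= => /andP[at_ tb]; apply: dfP; rewrite !ltW.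
- apply: continuous_in_subspaceT => t; rewrite inE /= in_itv/= => tab.
  exact: rderive_continuous (dfP _ tab).
rewrite in_itv/= => tab ->; apply: ler_wpM2r; first by rewrite subr_ge0.
exact: cdf.
Qed.

(** Coefficients that decay like those of an exponential function; this class
    is stable under termwise differentiation, whence differentiability of the
    sum of the power series everywhere. *)
Definition exp_type (c : nat -> R) :=
  exists M B : R, [/\ 0 <= M, 0 <= B & forall n, `|c n| <= M * (B ^+ n / n`!%:R)].

Lemma exp_type_diffs (c : nat -> R) : exp_type c -> exp_type (pseries_diffs c).
Proof.
move=> [M [B [M0 B0 cMB]]]; exists (M * B), B; split => [|//|n].
  exact: mulr_ge0.
rewrite /pseries_diffs normrM ger0_norm ?ler0n//.
apply: le_trans (ler_wpM2l _ (cMB _)) _; first exact: ler0n.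
rewrite factS natrM exprS.
have n1 : n.+1%:R != 0 :> R by rewrite pnatr_eq0.
have nf : n`!%:R != 0 :> R by rewrite pnatr_eq0 -lt0n fact_gt0.
rewrite le_eqVlt; apply/orP; left; apply/eqP; move: (n.+1%:R) n1 => a a0.
by field; rewrite nf a0.
Qed.

Lemma exp_type_cvg (c : nat -> R) t : exp_type c -> cvgn (pseries c t).
Proof.
move=> [M [B [M0 B0 cMB]]]; apply: normed_cvg.
have := @is_cvg_seriesZ _ _ M (is_cvg_series_exp_coeff (B * `|t|)).
apply: series_le_cvg => [n|n|n].
- exact: normr_ge0.
- by apply: mulr_ge0 => //; apply: exp_coeff_ge0; exact: mulr_ge0.
- rewrite /GRing.scale /= /exp_coeff /= normrM normrX exprMn.
  rewrite [leRHS](_ : _ = M * (B ^+ n / n`!%:R) * `|t| ^+ n);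
    last by rewrite -[LHS]/(M * _); ring.
  apply: ler_wpM2r; first exact: exprn_ge0.
  exact: cMB.
Qed.

Lemma exp_type_derive (c : nat -> R) t : exp_type c ->
  is_derive t 1 (fun s => limn (pseries c s)) (limn (pseries (pseries_diffs c) t)).
Proof.
move=> ec; apply: (@pseries_snd_diffs R c (`|t| + 1)).
- exact: exp_type_cvg.
- exact/exp_type_cvg/exp_type_diffs.
- exact/exp_type_cvg/exp_type_diffs/exp_type_diffs.
- by rewrite [ltRHS]ger0_norm ?ltrDl// addr_ge0.
Qed.

End RealCalculus.

(** * The logarithmic mean *)

Section LogarithmicMean.
Context {R : realType}.
Implicit Types r s u : R.

(** The function $(e^u - 1) / u$. Homogeneity reduces the logarithmic mean to it,
    $\theta_{log}(r,s) = r\varphi(\ln(s/r))$, which avoids two-variable calculus;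
    the power series makes it smooth at 0, that is, on the diagonal $r = s$. *)
Definition exprel u : R := limn (pseries (fun n => (n.+1`!%:R)^-1) u).

Definition dexprel u : R :=
  limn (pseries (pseries_diffs (fun n => (n.+1`!%:R)^-1)) u).

Let exprel_coef : exp_type (fun n => (n.+1`!%:R)^-1 : R).
Proof.
exists 1, 1; split => // n; rewrite expr1n mul1r div1r ger0_norm ?invr_ge0 ?ler0n//.
by rewrite lef_pV2 ?posrE ?ltr0n ?fact_gt0// ler_nat factS leq_pmull.
Qed.

Lemma derive_exprel u : is_derive u 1 exprel (dexprel u).
Proof. exact: exp_type_derive exprel_coef. Qed.

Lemma exprelE u : u * exprel u = expR u - 1.
Proof.
apply/esym; rewrite /exprel /expR.
have ce := @is_cvg_series_exp_coeff R u.
have cp := exp_type_cvg _ u exprel_coef.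
apply/eqP; rewrite subr_eq addrC; apply/eqP.
apply/cvg_lim => //.
rewrite -(cvg_shiftS (series (exp_coeff u))) /=.
rewrite (_ : (fun n => _) = (fun n => 1 + u * pseries (fun n => (n.+1`!%:R)^-1) u n)).
  by apply: cvgD; [exact: cvg_cst|apply: cvgM; [exact: cvg_cst|exact: cp]].
apply/funext => n; rewrite /series /= big_nat_recl// /exp_coeff /= expr0 fact0 divr1.
congr (_ + _); rewrite mulr_sumr; apply: eq_bigr => i _.
by rewrite exprS /=; ring.
Qed.

Lemma exprel0 : exprel 0 = 1.
Proof.
rewrite /exprel; apply/cvg_lim => //.
rewrite -(cvg_shiftS (pseries _ 0)) /=.
rewrite (_ : (fun n => _) = (fun n => 1)); first exact: cvg_cst.
apply/funext => n; rewrite /pseries /series /= big_nat_recl//= expr0 mulr1 invr1.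
by rewrite big1 ?addr0// => i _; rewrite expr0n mulr0.
Qed.

Lemma exprel_gt0 u : 0 < exprel u.
Proof.
have [->|u0] := eqVneq u 0; first by rewrite exprel0.
have e := exprelE u; have e1 := expR_gt1 u; have e2 := expR_lt1 u.
case: (ltgtP u 0) u0 => // uu _.
- by rewrite uu in e2; move: e2 => /esym e2; nra.
- by rewrite uu in e1; move: e1 => /esym e1; nra.
Qed.

Lemma exprelN u : exprel (- u) = expR (- u) * exprel u.
Proof.
have [->|u0] := eqVneq u 0; first by rewrite oppr0 expR0 mul1r.
apply: (mulfI (x := - u)); first by rewrite oppr_eq0.
rewrite exprelE mulrCA mulNr exprelE mulrN mulrBr mulr1 -expRD addNr expR0.
by rewrite opprB.
Qed.

Lemma dexprelN u : dexprel (- u) = expR (- u) * (exprel u - dexprel u).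
Proof.
have d1 := rderive_comp (derive_exprel (- u)) (rderive_opp (rderive_id u)).
have d2 := rderive_mul (rderive_comp (is_derive_expR (- u))
  (rderive_opp (rderive_id u))) (derive_exprel u).
have e : (fun s : R => exprel (- s)) = (fun s => expR (- s) * exprel s).
  by apply/funext => s; exact: exprelN.
rewrite e in d1; have := @derive_val _ _ _ _ _ _ _ d1.
rewrite (@derive_val _ _ _ _ _ _ _ d2) => h.
by apply: oppr_inj; rewrite -mulrN1 -h; ring.
Qed.

(** For the logarithmic mean this is the bound by the sum of the arguments. Even
    the larger argument suffices, by $1 + x \le e^x$ at $x = u$ or $x = -u$. *)
Lemma exprel_le u : exprel u <= 1 + expR u.
Proof.
have e := exprelE u; have ep := expR_gt0 u.
case: (ltgtP u 0) => [u0|u0|->]; last by rewrite exprel0 expR0; lra.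
- have : exprel u <= 1.
    by rewrite -(ler_nM2l u0) e mulr1 lerBrDl; exact: expR_ge1Dx.
  by lra.
- have : exprel u <= expR u.
    rewrite -(ler_pM2l u0) e.
    have := ler_wpM2l (ltW ep) (expR_ge1Dx (- u)).
    by rewrite expRxMexpNx_1 mulrDr mulr1 mulrN [u * _]mulrC; lra.
  by lra.
Qed.

Lemma theta_logE r s : 0 < r -> 0 < s ->
  theta_log r s = r * exprel (ln s - ln r).
Proof.
move=> r0 s0; rewrite /theta_log.
set u := ln s - ln r.
have -> : (fun p => r `^ (1 - p) * s `^ p) = (fun p => r * expR (u * p)).
  apply/funext => p; rewrite /powR !gt_eqF//.
  rewrite -[in RHS](@lnK _ r) ?posrE// -!expRD; congr expR; rewrite /u; ring.
have [u0|u0] := eqVneq u 0.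
  rewrite u0 exprel0.
  under eq_Rintegral do rewrite mul0r expR0.
  rewrite Rintegral_cst//= lebesgue_measure_itv/= lte_fin ltr01.
  by rewrite oppr0 addr0 -[fine _]/(1 : R) !mulr1.
have dF (p : R) : is_derive p 1 (fun p => r / u * expR (u * p)) (r * expR (u * p)).
  apply: is_derive_eq (rderive_mull (r / u)
    (rderive_comp (is_derive_expR (u * p)) (rderive_mull u (rderive_id p)))) _.
  by field.
have cf : continuous (fun p : R => r * expR (u * p)).
  move=> p; exact: rderive_continuous (rderive_mull r
    (rderive_comp (is_derive_expR (u * p)) (rderive_mull u (rderive_id p)))).
rewrite /Rintegral (@continuous_FTC2 _ _ (fun p => r / u * expR (u * p))) //.
- rewrite /= mulr1 mulr0 expR0; apply: (mulfI u0).
  rewrite mulrCA exprelE; field; exact: u0.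
- exact: continuous_subspaceT.
- split.
  + by move=> p _; case: (dF p).
  + exact/cvg_at_right_filter/(rderive_continuous (dF 0)).
  + exact/cvg_at_left_filter/(rderive_continuous (dF 1)).
- by move=> p _; rewrite derive1E; exact: (@derive_val _ _ _ _ _ _ _ (dF p)).
Qed.

Lemma theta_log_gt0 r s : 0 < r -> 0 < s -> 0 < theta_log r s.
Proof. by move=> r0 s0; rewrite theta_logE// mulr_gt0// exprel_gt0. Qed.

Lemma theta_logxx r : 0 < r -> theta_log r r = r.
Proof. by move=> r0; rewrite theta_logE// subrr exprel0 mulr1. Qed.

Lemma theta_log_leD r s : 0 < r -> 0 < s -> theta_log r s <= r + s.
Proof.
move=> r0 s0; rewrite theta_logE//.
apply: le_trans (ler_wpM2l (ltW r0) (exprel_le _)) _.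
by rewrite expRB !lnK ?posrE// mulrDr mulr1 mulrCA divff ?gt_eqF// mulr1.
Qed.

Lemma d1_theta_logE r s : 0 < r -> 0 < s ->
  d1_theta_log r s = exprel (ln s - ln r) - dexprel (ln s - ln r).
Proof.
move=> r0 s0; rewrite /d1_theta_log derive1E.
have d := rderive_mul (rderive_id r)
  (rderive_comp (g := fun v => ln s - ln v) (derive_exprel (ln s - ln r))
  (rderive_sub (is_derive_cst (ln s) r 1) (is_derive1_ln r0))).
rewrite (@near_eq_derive _ _ _ _ (fun v : R => v * exprel (ln s - ln v))).
  rewrite (@derive_val _ _ _ _ _ _ _ d); field; exact: lt0r_neq0.
by near=> v; apply: theta_logE => //; near: v; exact: lt_nbhsr.
Unshelve. all: by end_near. Qed.

(** Chain rule for the logarithmic mean along a positive curve; by symmetry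
    both partial derivatives are values of [d1_theta_log]. *)
Lemma derive_theta_log (r s : R -> R) t dr ds :
  0 < r t -> 0 < s t ->
  is_derive t 1 r dr -> is_derive t 1 s ds ->
  is_derive t 1 (fun u => theta_log (r u) (s u))
    (d1_theta_log (r t) (s t) * dr + d1_theta_log (s t) (r t) * ds).
Proof.
move=> r0 s0 dr1 ds1.
apply: (@near_eq_is_derive R R R (fun u : R => r u * exprel (ln (s u) - ln (r u)))).
  near=> u; rewrite theta_logE//; near: u.
    by apply: cvgr_gt; [exact: rderive_continuous dr1|exact: r0].
  by apply: cvgr_gt; [exact: rderive_continuous ds1|exact: s0].
apply: is_derive_eq (rderive_mul dr1
  (rderive_comp (g := fun v => ln (s v) - ln (r v)) (derive_exprel _)
  (rderive_sub (rderive_comp (is_derive1_ln s0) ds1)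
              (rderive_comp (is_derive1_ln r0) dr1)))) _.
rewrite !d1_theta_logE// -[ln (r t) - ln (s t)]opprB exprelN dexprelN.
rewrite opprB expRB !lnK ?posrE//.
by field; rewrite !lt0r_neq0.
Unshelve. all: by end_near. Qed.

(** Euler's identity for a function homogeneous of degree 1. *)
Lemma theta_log_euler r s : 0 < r -> 0 < s ->
  r * d1_theta_log r s + s * d1_theta_log s r = theta_log r s.
Proof.
move=> r0 s0; rewrite !d1_theta_logE// theta_logE// -[ln r - ln s]opprB.
rewrite exprelN dexprelN opprB expRB !lnK ?posrE//.
by field; rewrite lt0r_neq0.
Qed.

End LogarithmicMean.
(** * Exponentials of kernel operators *)

Section KernelExponential.
Context {R : realType} {X : finType}.
Implicit Types (K : X -> X -> R) (f g : X -> R) (t : R).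

Definition kernel_op K f : X -> R := fun x => \sum_y K x y * f y.

Definition kernel_exp K t f : X -> R :=
  fun x => limn (series (fun n => t ^+ n / n`!%:R * iter n (kernel_op K) f x)).

Let coef K f x n : R := iter n (kernel_op K) f x / n`!%:R.

Lemma kernel_op_iter_sum (I : finType) K (c : I -> R) (F : I -> X -> R) n x :
  iter n (kernel_op K) (fun z => \sum_i c i * F i z) x =
  \sum_i c i * iter n (kernel_op K) (F i) x.
Proof.
elim: n x => [//|n IH] x; rewrite !iterS /kernel_op.
under eq_bigr do rewrite IH mulr_sumr.
rewrite exchange_big /=; apply: eq_bigr => i _.
by rewrite mulr_sumr; apply: eq_bigr => y _; rewrite mulrCA.
Qed.

Lemma exp_type_kernel_op K f x : exp_type (coef K f x).
Proof.
pose B := \sum_x \sum_y `|K x y|; pose M := \sum_x `|f x|.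
have B0 : 0 <= B by apply: sumr_ge0 => ? _; exact: sumr_ge0.
have M0 : 0 <= M by exact: sumr_ge0.
have bnd n y : `|iter n (kernel_op K) f y| <= M * B ^+ n.
  elim: n y => [|n IH] y.
    by rewrite expr0 mulr1 /M (bigD1 y)//= lerDl sumr_ge0.
  rewrite iterS exprS mulrCA; apply: le_trans (ler_norm_sum _ _ _) _.
  apply: (@le_trans _ _ (\sum_z `|K y z| * (M * B ^+ n))).
    by apply: ler_sum => z _; rewrite normrM ler_wpM2l.
  rewrite -mulr_suml; apply: ler_wpM2r; first by rewrite mulr_ge0// exprn_ge0.
  rewrite /B [leRHS](bigD1 y)//= lerDl; apply: sumr_ge0 => ? _; exact: sumr_ge0.
exists M, B; split => // n.
rewrite /coef normrM mulrA [X in _ * X]ger0_norm ?invr_ge0 ?ler0n//.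
by apply: ler_wpM2r (bnd n x); rewrite invr_ge0 ler0n.
Qed.

Let kernel_exp_pseries K t f x :
  series (fun n => t ^+ n / n`!%:R * iter n (kernel_op K) f x)
  = pseries (coef K f x) t.
Proof.
apply/funext => n; rewrite /pseries /series /=; apply: eq_bigr => i _.
by rewrite /coef; ring.
Qed.

Lemma kernel_exp_cvg K t f x :
  (series (fun n => t ^+ n / n`!%:R * iter n (kernel_op K) f x) @ \oo
    --> kernel_exp K t f x)%classic.
Proof.
by rewrite /kernel_exp kernel_exp_pseries; exact: exp_type_cvg (exp_type_kernel_op K f x).
Qed.

Lemma derive_kernel_exp K f x t :
  is_derive t 1 (fun s => kernel_exp K s f x) (kernel_exp K t (kernel_op K f) x).
Proof.
rewrite /kernel_exp kernel_exp_pseries.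
under eq_fun do rewrite kernel_exp_pseries.
rewrite (_ : coef K (kernel_op K f) x = pseries_diffs (coef K f x)).
  exact: exp_type_derive (exp_type_kernel_op K f x).
apply/funext => n; rewrite /pseries_diffs /coef iterSr factS natrM.
have n1 : n.+1%:R != 0 :> R by rewrite pnatr_eq0.
have nf : n`!%:R != 0 :> R by rewrite pnatr_eq0 -lt0n fact_gt0.
by move: (n.+1%:R) n1 => a a0; field; rewrite nf a0.
Qed.

Lemma kernel_exp0 K f x : kernel_exp K 0 f x = f x.
Proof.
apply/cvg_lim => //.
rewrite -(cvg_shiftS (series _)) /=.
rewrite (_ : (fun n => _) = (fun n => f x)); first exact: cvg_cst.
apply/funext => n; rewrite /series /= big_nat_recl//= expr0 fact0 divr1 mul1r.
by rewrite big1 ?addr0// => i _; rewrite expr0n !mul0r.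
Qed.

Lemma kernel_exp_sum (I : finType) K t (c : I -> R) (F : I -> X -> R) x :
  kernel_exp K t (fun z => \sum_i c i * F i z) x =
  \sum_i c i * kernel_exp K t (F i) x.
Proof.
apply/cvg_lim => //.
rewrite (_ : series _ = fun n => \sum_i c i *
    series (fun n => t ^+ n / n`!%:R * iter n (kernel_op K) (F i) x) n).
  apply: cvg_big => [|i _]; first exact: add_continuous.
  by apply: cvgM; [exact: cvg_cst|exact: kernel_exp_cvg].
apply/funext => n; rewrite /series /=.
under [RHS]eq_bigr do rewrite mulr_sumr.
rewrite exchange_big /=; apply: eq_bigr => k _.
rewrite kernel_op_iter_sum mulr_sumr; apply: eq_bigr => i _.
by rewrite mulrCA.
Qed.

Lemma sum_indicator f x : \sum_y f y * (x == y)%:R = f x.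
Proof.
rewrite (bigD1 x)//= eqxx mulr1 big1 ?addr0// => y /negPf yx.
by rewrite eq_sym yx mulr0.
Qed.

Lemma kernel_exp_indicator K t f x :
  kernel_exp K t f x = \sum_y f y * kernel_exp K t (fun z => (z == y)%:R) x.
Proof.
rewrite -kernel_exp_sum; congr (kernel_exp _ _ _ _).
by apply/funext => z; rewrite sum_indicator.
Qed.

Lemma kernel_exp_op K t f x :
  kernel_exp K t (kernel_op K f) x = kernel_op K (kernel_exp K t f) x.
Proof.
apply/cvg_lim => //.
rewrite (_ : series _ = fun n => \sum_y K x y *
    series (fun n => t ^+ n / n`!%:R * iter n (kernel_op K) f y) n).
  apply: cvg_big => [|i _]; first exact: add_continuous.
  by apply: cvgM; [exact: cvg_cst|exact: kernel_exp_cvg].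
apply/funext => n; rewrite /series /=.
under [RHS]eq_bigr do rewrite mulr_sumr.
rewrite exchange_big /=; apply: eq_bigr => k _.
rewrite -iterSr iterS /kernel_op mulr_sumr; apply: eq_bigr => i _.
by rewrite mulrCA.
Qed.

Lemma kernel_exp_ge K t f x : (forall x y, 0 <= K x y) -> (forall x, 0 <= f x) ->
  0 <= t -> f x <= kernel_exp K t f x.
Proof.
move=> K0 f0 t0.
have it0 n y : 0 <= iter n (kernel_op K) f y.
  elim: n y => [//|n IH] y; rewrite iterS.
  by apply: sumr_ge0 => z _; rewrite mulr_ge0.
have term0 n : 0 <= t ^+ n / n`!%:R * iter n (kernel_op K) f x.
  by rewrite mulr_ge0// divr_ge0 ?exprn_ge0 ?ler0n.
have nd : nondecreasing_seq
    (series (fun n => t ^+ n / n`!%:R * iter n (kernel_op K) f x)).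
  by apply: nondecreasing_series => n _ _; exact: term0.
have := nondecreasing_cvgn_le nd (cvgP _ (kernel_exp_cvg K t f x)) 1%N.
by rewrite {1}/series /= big_nat1 expr0 fact0 divr1 mul1r.
Qed.

End KernelExponential.

(** * The heat semigroup of a reversible chain *)

Section Chain.
Context {R : realType} {X : finType} (Q : X -> X -> R) (pi : X -> R).
Hypothesis hchain : markov_chain Q pi.
Implicit Types (f g rho : X -> R) (s t : R).

Let Q_ge0 x y : 0 <= Q x y.
Proof. by case/andP: (chain_Q01 hchain x y). Qed.

Let pi_gt0 x : 0 < pi x.
Proof. by case/andP: (chain_pi01 hchain x). Qed.

Let pi_ge0 x : 0 <= pi x. Proof. exact: ltW. Qed.

Definition edge_sum (F : X -> X -> R) := \sum_x \sum_y F x y * (Q x y * pi x).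

Lemma edge_ge0 x y : 0 <= Q x y * pi x.
Proof. by rewrite mulr_ge0 ?Q_ge0 ?pi_ge0. Qed.

Lemma edge_sumC F : edge_sum (fun x y => F y x) = edge_sum F.
Proof.
rewrite /edge_sum exchange_big /=; apply: eq_bigr => x _.
by apply: eq_bigr => y _; rewrite (chain_reversible hchain y x).
Qed.

Lemma edge_sumD F G :
  edge_sum (fun x y => F x y + G x y) = edge_sum F + edge_sum G.
Proof.
rewrite /edge_sum -big_split /=; apply: eq_bigr => x _.
by rewrite -big_split /=; apply: eq_bigr => y _; rewrite mulrDl.
Qed.

Lemma edge_sumZ c F : edge_sum (fun x y => c * F x y) = c * edge_sum F.
Proof.
rewrite /edge_sum mulr_sumr; apply: eq_bigr => x _.
by rewrite mulr_sumr; apply: eq_bigr => y _; rewrite -mulrA.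
Qed.

Lemma edge_sumB F G :
  edge_sum (fun x y => F x y - G x y) = edge_sum F - edge_sum G.
Proof.
rewrite -[- edge_sum G]mulN1r -edge_sumZ -edge_sumD; congr edge_sum.
by apply/funext => x; apply/funext => y; rewrite mulN1r.
Qed.

Lemma eq_edge_sum F G : (forall x y, F x y = G x y) -> edge_sum F = edge_sum G.
Proof. by move=> FG; apply: eq_bigr => x _; apply: eq_bigr => y _; rewrite FG. Qed.

Lemma ler_edge_sum F G : (forall x y, 0 < Q x y -> F x y <= G x y) ->
  edge_sum F <= edge_sum G.
Proof.
move=> FG; apply: ler_sum => x _; apply: ler_sum => y _.
have [Qxy|Qxy] := ltP 0 (Q x y).
  by apply: ler_wpM2r; [exact: edge_ge0|exact: FG].
by have -> : Q x y = 0; [apply/eqP; rewrite eq_le Qxy /=|rewrite mul0r !mulr0].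
Qed.

Lemma edge_sum_ge0 F : (forall x y, 0 <= F x y) -> 0 <= edge_sum F.
Proof.
by move=> F0; apply: sumr_ge0 => x _; apply: sumr_ge0 => y _; rewrite mulr_ge0 ?edge_ge0.
Qed.

Lemma edge_sum_sym F : edge_sum F = 2^-1 * edge_sum (fun x y => F x y + F y x).
Proof. by rewrite edge_sumD edge_sumC; field. Qed.

Lemma innerC f g : inner pi f g = inner pi g f.
Proof. by apply: eq_bigr => x _; rewrite [f x * _]mulrC. Qed.

Lemma inner_laplacian f g :
  inner pi f (laplacian Q g) = edge_sum (fun x y => f x * (g y - g x)).
Proof.
apply: eq_bigr => x _; rewrite /laplacian mulr_sumr mulr_suml.
by apply: eq_bigr => y _; rewrite -!mulrA.
Qed.

(** Green's formula. *)
Lemma green f g : inner pi f (laplacian Q g) =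
  - (2^-1 * edge_sum (fun x y => (f y - f x) * (g y - g x))).
Proof.
rewrite inner_laplacian edge_sum_sym -mulrN; congr (_ * _).
rewrite -mulN1r -edge_sumZ; apply: eq_edge_sum => x y; ring.
Qed.

Lemma laplacian_sym f g : inner pi (laplacian Q f) g = inner pi f (laplacian Q g).
Proof.
rewrite innerC !green; congr (- (_ * _)).
by apply: eq_edge_sum => x y; rewrite mulrC.
Qed.

Lemma laplacian_kernel f x :
  laplacian Q f x = kernel_op (fun x y => Q x y - (x == y)%:R) f x.
Proof.
rewrite /kernel_op; under [RHS]eq_bigr do rewrite mulrBl [_%:R * _]mulrC.
rewrite sumrB sum_indicator /laplacian.
under eq_bigr do rewrite mulrBl [f _ * _]mulrC.
by rewrite sumrB -mulr_sumr (chain_Q_sum hchain) mulr1.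
Qed.

Lemma laplacianE f x : laplacian Q f x = kernel_op Q f x - f x.
Proof.
rewrite laplacian_kernel /kernel_op.
under [LHS]eq_bigr do rewrite mulrBl [_%:R * _]mulrC.
by rewrite sumrB sum_indicator.
Qed.

Let lap := fun x y => Q x y - (x == y)%:R.

Lemma heat_kernel_exp t f : heat Q t f = kernel_exp lap t f.
Proof.
have -> : kernel_exp lap t f = heat Q t f; last by [].
rewrite /heat /kernel_exp.
by have -> : laplacian Q = kernel_op lap
  by apply/funext => g; apply/funext => x; exact: laplacian_kernel.
Qed.

Lemma heat_laplacian t f x :
  heat Q t (laplacian Q f) x = laplacian Q (heat Q t f) x.
Proof.
rewrite !heat_kernel_exp laplacian_kernel -kernel_exp_op.
by congr (kernel_exp _ _ _ _); apply/funext => y; exact: laplacian_kernel.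
Qed.

Lemma derive_heat f x t :
  is_derive t 1 (fun s => heat Q s f x) (laplacian Q (heat Q t f) x).
Proof.
rewrite heat_kernel_exp laplacian_kernel -kernel_exp_op.
under eq_fun do rewrite heat_kernel_exp.
exact: derive_kernel_exp.
Qed.

Lemma heat0 f x : heat Q 0 f x = f x.
Proof. by rewrite heat_kernel_exp kernel_exp0. Qed.

Lemma heat_indicator t f x :
  heat Q t f x = \sum_y f y * heat Q t (fun z => (z == y)%:R) x.
Proof.
rewrite heat_kernel_exp kernel_exp_indicator.
by apply: eq_bigr => y _; rewrite heat_kernel_exp.
Qed.

Lemma derive_inner (a b : R -> X -> R) (da db : X -> R) t :
  (forall x, is_derive t 1 (fun s => a s x) (da x)) ->
  (forall x, is_derive t 1 (fun s => b s x) (db x)) ->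
  is_derive t 1 (fun s => inner pi (a s) (b s))
    (inner pi da (b t) + inner pi (a t) db).
Proof.
move=> Da Db.
have D x := rderive_mulr (pi x) (rderive_mul (Da x) (Db x)).
apply: is_derive_eq (rderive_sum _ _ _ _ D) _.
by rewrite /inner -big_split; apply: eq_bigr => x _; rewrite mulrDl.
Qed.

(** The symmetry of the Laplacian cancels the two terms of the derivative in
    [s]. Stated for arbitrary solutions of the heat equation, this yields the
    symmetry of the heat semigroup, its semigroup law inside pairings, and the
    identification of $P_t$ with any other solution operator. *)
Lemma pairing_const (a b : R -> X -> R) s t :
  (forall (u : R) x, is_derive u 1 (fun v => a v x) (laplacian Q (a u) x)) ->
  (forall (u : R) x, is_derive u 1 (fun v => b v x) (laplacian Q (b u) x)) ->
  inner pi (a s) (b (t - s)) = inner pi (a 0) (b t).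
Proof.
move=> Da Db; rewrite -[in RHS](subr0 t).
pose F u := inner pi (a u) (b (t - u)); rewrite -/(F s) -/(F 0).
apply: is_derive_0_is_cst => u.
apply: is_derive_eq (derive_inner _ _ _ _ _ (Da u)
  (fun x => rderive_rev (Db (t - u) x))) _.
rewrite laplacian_sym /inner -big_split big1 //= => x _; ring.
Qed.

Lemma heat_pairing s t f g :
  inner pi (heat Q s f) (heat Q (t - s) g) = inner pi f (heat Q t g).
Proof.
have /= -> := pairing_const (fun u => heat Q u f) (fun u => heat Q u g) s t
  (fun u x => derive_heat f x u) (fun u x => derive_heat g x u).
by apply: eq_bigr => x _; rewrite heat0.
Qed.

Lemma heat_sym t f g : inner pi (heat Q t f) g = inner pi f (heat Q t g).
Proof.
rewrite -(heat_pairing t) subrr.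
by apply: eq_bigr => x _; rewrite heat0.
Qed.

Lemma inner_indicator f x : inner pi f (fun z => (z == x)%:R) = f x * pi x.
Proof.
rewrite /inner (bigD1 x)//= eqxx mulr1 big1 ?addr0// => y /negPf ->.
by rewrite mulr0 mul0r.
Qed.

(** As $\Delta = Q - 1$, one has $P_t = e^{-t} e^{tQ}$, and the second factor is
    a series with nonnegative terms on nonnegative functions: the source of
    positivity. *)
Lemma heat_eq_kernel_exp t f x : heat Q t f x = expR (- t) * kernel_exp Q t f x.
Proof.
apply: (mulIf (lt0r_neq0 (pi_gt0 x))).
rewrite -(inner_indicator (heat Q t f)) heat_sym.
rewrite -(inner_indicator (fun y => expR (- t) * kernel_exp Q t f y)).
have Da (u : R) y : is_derive u 1 (fun v => expR (- v) * kernel_exp Q v f y)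
    (laplacian Q (fun z => expR (- u) * kernel_exp Q u f z) y).
  apply: is_derive_eq (rderive_mul (rderive_comp (is_derive_expR (- u))
    (rderive_opp (rderive_id u))) (derive_kernel_exp Q f y u)) _.
  rewrite kernel_exp_op laplacianE /kernel_op.
  under [in RHS]eq_bigr do rewrite mulrCA.
  by rewrite -mulr_sumr; ring.
have /= := pairing_const (fun u x => expR (- u) * kernel_exp Q u f x)
  (fun u => heat Q u _) t t Da (fun u y => derive_heat (fun z => (z == x)%:R) y u).
rewrite subrr => E; apply/esym; move: E; congr (_ = _).
  by apply: eq_bigr => y _; rewrite heat0.
by apply: eq_bigr => y _; rewrite oppr0 expR0 mul1r kernel_exp0.
Qed.

Lemma heat_ge0 t f : 0 <= t -> (forall x, 0 <= f x) -> forall x, 0 <= heat Q t f x.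
Proof.
move=> t0 f0 x; rewrite heat_eq_kernel_exp mulr_ge0 ?expR_ge0//.
by apply: le_trans (f0 x) _; exact: kernel_exp_ge.
Qed.

Lemma heat_gt0 t f : 0 <= t -> (forall x, 0 < f x) -> forall x, 0 < heat Q t f x.
Proof.
move=> t0 f0 x; rewrite heat_eq_kernel_exp mulr_gt0 ?expR_gt0//.
by apply: lt_le_trans (f0 x) _; apply: kernel_exp_ge => // y; exact: ltW.
Qed.

Lemma heat_lin t a b f g x : heat Q t (fun z => a * f z + b * g z) x =
  a * heat Q t f x + b * heat Q t g x.
Proof.
rewrite heat_indicator (heat_indicator t f) (heat_indicator t g).
rewrite !mulr_sumr -big_split; apply: eq_bigr => y _ /=.
by rewrite mulrDl !mulrA.
Qed.

Lemma heat_cst t c x : heat Q t (fun=> c) x = c.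
Proof.
have D (s : R) : is_derive s 1 (fun u => heat Q u (fun=> c) x) 0.
  apply: is_derive_eq (derive_heat _ _ _) _.
  rewrite -heat_laplacian heat_indicator big1// => y _.
  by rewrite /laplacian big1 ?mul0r// => z _; rewrite subrr mul0r.
by rewrite (@is_derive_0_is_cst R _ t 0 D) heat0.
Qed.

Lemma heat_mass t f : inner pi (heat Q t f) (fun=> 1) = inner pi f (fun=> 1).
Proof. by rewrite heat_sym; apply: eq_bigr => x _; rewrite heat_cst. Qed.

(** * Gradient estimates from entropic curvature *)

(** The action functional whose monotonicity along the heat flow encodes the
    entropic curvature condition. *)
Definition action rho f :=
  2^-1 * edge_sum (fun x y => theta_log (rho x) (rho y) * (f y - f x) ^+ 2).

Lemma inner_Gamma_rho rho w f g : inner pi w (Gamma_rho Q rho f g) =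
  edge_sum (fun x y => w x * d1_theta_log (rho x) (rho y) *
    ((f y - f x) * (g y - g x))).
Proof.
apply: eq_bigr => x _; rewrite /Gamma_rho /laplacian_rho.
rewrite !mulr_sumr -!sumrB mulr_suml mulr_sumr mulr_suml.
by apply: eq_bigr => y _; field.
Qed.

(** The right-hand side is what the product rule yields for the derivative of the
    action along the heat flow. The two forms agree after symmetrising over the
    edges, the second term by Euler's identity for the logarithmic mean. *)
Lemma inner_Gamma2_rho rho f : (forall x, 0 < rho x) ->
  2 * inner pi rho (Gamma2_rho Q rho f f) =
  edge_sum (fun x y => laplacian Q rho x * d1_theta_log (rho x) (rho y) *
    (f y - f x) ^+ 2) -
  edge_sum (fun x y => theta_log (rho x) (rho y) *
    ((f y - f x) * (laplacian Q f y - laplacian Q f x))).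
Proof.
move=> rho0.
have -> : 2 * inner pi rho (Gamma2_rho Q rho f f) =
    inner pi rho (laplacian Q (Gamma_rho Q rho f f)) -
    2 * inner pi rho (Gamma_rho Q rho f (laplacian Q f)).
  rewrite /inner !mulr_sumr -sumrB; apply: eq_bigr => x _.
  by rewrite /Gamma2_rho; field.
rewrite -laplacian_sym !inner_Gamma_rho; congr (_ - _).
rewrite edge_sum_sym mulrA divff// mul1r; apply: eq_edge_sum => x y.
rewrite -(theta_log_euler _ _ (rho0 x) (rho0 y)).
move: (d1_theta_log _ _) (d1_theta_log _ _) (laplacian _ _ _) (laplacian _ _ _).
by move=> a b c d; ring.
Qed.

Lemma derive_action rho f s t : 0 <= s -> (forall x, 0 < rho x) ->
  is_derive s 1 (fun u => action (heat Q u rho) (heat Q (t - u) f))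
    (2 * inner pi (heat Q s rho)
       (Gamma2_rho Q (heat Q s rho) (heat Q (t - s) f) (heat Q (t - s) f))).
Proof.
move=> s0 rho0.
have r0 := heat_gt0 _ _ s0 rho0.
have Dg x : is_derive s 1 (fun u => heat Q (t - u) f x)
    (- laplacian Q (heat Q (t - s) f) x) := rderive_rev (derive_heat f x (t - s)).
have Dxy x y := rderive_mulr (Q x y * pi x) (rderive_mul
  (derive_theta_log _ _ _ _ _ (r0 x) (r0 y) (derive_heat rho x s) (derive_heat rho y s))
  (rderive_mul (rderive_sub (Dg y) (Dg x)) (rderive_sub (Dg y) (Dg x)))).
have D := rderive_mull 2^-1
  (rderive_sum _ _ _ _ (fun x => rderive_sum _ _ _ _ (Dxy x))).
apply: is_derive_eq D _.
rewrite inner_Gamma2_rho//.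
set r := heat Q s rho; set g := heat Q (t - s) f.
rewrite [X in _ = X - _]edge_sum_sym -[X in _ = _ - X](mulKf (_ : 2 != 0 :> R))//.
rewrite -mulrBr; congr (_ * _).
rewrite -edge_sumZ -edge_sumB; apply: eq_edge_sum => x y; rewrite -/r -/g.
move: (d1_theta_log _ _) (d1_theta_log _ _) (theta_log _ _).
move: (laplacian _ _ _) (laplacian _ _ _) (laplacian _ _ _) (laplacian _ _ _).
move: (r x) (r y) (g x) (g y) => rx ry gx gy a b c d e h k.
by ring.
Qed.

Hypothesis hCD : CD_ent_0_oo Q pi.

(** The interpolation $s \mapsto A(P_s\rho, P_{t-s} f)$ has derivative
    $2\langle P_s\rho, \Gamma_{2,P_s\rho} P_{t-s}f\rangle_\pi$, which is
    nonnegative by the curvature condition. *)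
Lemma action_heat_le rho f s t : 0 <= s -> (forall x, 0 < rho x) ->
  action rho (heat Q t f) <= action (heat Q s rho) (heat Q (t - s) f).
Proof.
move=> s0 rho0.
have := rderive_growth (fun u => action (heat Q u rho) (heat Q (t - u) f)) _ 0 s 0 s0
  (fun u us => derive_action rho f u t (proj1 (andP us)) rho0).
rewrite mul0r subr0 subr_ge0 (_ : heat Q 0 rho = rho); last first.
  by apply/funext => x; rewrite heat0.
apply=> u /andP[u0 _]; rewrite mulr_ge0//; apply: hCD; exact: heat_gt0.
Qed.

(** As the logarithmic mean is dominated by the sum of its arguments,
    $\langle P_s\rho, (P_{t-s}f)^2\rangle_\pi$ grows at least at the rate
    $A(P_s\rho, P_{t-s}f)$, which [action_heat_le] bounds from below uniformly
    in $s$. *)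
Lemma reverse_poincare rho f t : 0 <= t -> (forall x, 0 < rho x) ->
  t * action rho (heat Q t f) <= inner pi (heat Q t rho) (fun x => f x ^+ 2).
Proof.
move=> t0 rho0.
pose G u := inner pi (heat Q u rho) (fun x => heat Q (t - u) f x * heat Q (t - u) f x).
pose dG u := edge_sum (fun x y => heat Q u rho x *
  (heat Q (t - u) f y - heat Q (t - u) f x) ^+ 2).
have DG (u : R) : is_derive u 1 G (dG u).
  have Dg x : is_derive u 1 (fun v => heat Q (t - v) f x)
    (- laplacian Q (heat Q (t - u) f) x) := rderive_rev (derive_heat f x (t - u)).
  apply: is_derive_eq (derive_inner _ _ _ _ _ (fun x => derive_heat rho x u)
    (fun x => rderive_mul (Dg x) (Dg x))) _.
  set r := heat Q u rho; set g := heat Q (t - u) f.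
  rewrite laplacian_sym inner_laplacian.
  have -> : inner pi r (fun x => - laplacian Q g x * g x + g x * - laplacian Q g x) =
      - 2 * inner pi (fun x => r x * g x) (laplacian Q g).
    by rewrite /inner mulr_sumr; apply: eq_bigr => x _; ring.
  rewrite inner_laplacian -edge_sumZ -edge_sumD; apply: eq_edge_sum => x y.
  by rewrite -/r -/g; ring.
have G0 : 0 <= G 0.
  apply: sumr_ge0 => x _; apply: mulr_ge0 => //; apply: mulr_ge0.
    by rewrite heat0 ltW.
  by rewrite -expr2 sqr_ge0.
have -> : inner pi (heat Q t rho) (fun x => f x ^+ 2) = G t.
  by apply: eq_bigr => x _; rewrite /= subrr heat0 expr2.
have le1 : action rho (heat Q t f) * (t - 0) <= G t - G 0.
  apply: (rderive_growth G dG 0 t _ t0 (fun u _ => DG u)) => u /andP[u0 _].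
  apply: le_trans (action_heat_le rho f u t u0 rho0) _.
  have r0 := heat_gt0 _ _ u0 rho0.
  rewrite /action /dG [leRHS]edge_sum_sym ler_pM2l ?invr_gt0//.
  apply: ler_edge_sum => x y _.
  rewrite [X in _ <= _ + _ * X ^+ 2](_ : _ = - (heat Q (t - u) f y - heat Q (t - u) f x));
    last by ring.
  rewrite sqrrN -mulrDl; apply: ler_wpM2r; first exact: sqr_ge0.
  exact: theta_log_leD.
by rewrite mulrC -[X in _ * X]subr0; apply: le_trans le1 _; rewrite gerBl.
Qed.

Lemma Qmin_le x y : Defs.adjacent Q x y -> Qmin Q <= Q x y.
Proof.
move=> xy; exact: (bigmin_le_cond 1 (j := (x, y))
  (P := fun e => Defs.adjacent Q e.1 e.2) (fun e => Q e.1 e.2) xy).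
Qed.

Lemma Qmin_gt0 : 0 < Qmin Q.
Proof.
by apply: lt_bigmin => // e /andP[].
Qed.

Lemma Q_gt0_sym x y : 0 < Q x y -> 0 < Q y x.
Proof.
move=> xy; have := chain_reversible hchain x y.
have : 0 < Q x y * pi x by rewrite mulr_gt0.
by move=> + e; rewrite e pmulr_lgt0.
Qed.

Lemma edge_sum_ge2 F x y : (forall x y, 0 <= F x y) -> x != y ->
  (F x y + F y x) * (Q x y * pi x) <= edge_sum F.
Proof.
move=> F0 xy; rewrite mulrDl [X in _ + _ * X](chain_reversible hchain).
have e0 u v : 0 <= F u v * (Q u v * pi u) by rewrite mulr_ge0 ?edge_ge0.
rewrite /edge_sum (bigD1 x)//=; apply: lerD.
  by rewrite (bigD1 y)//= lerDl sumr_ge0.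
have yx : y != x by rewrite eq_sym.
rewrite (bigD1 y)//= (bigD1 x)//= -addrA lerDl.
by apply: addr_ge0; apply: sumr_ge0 => u _ //; exact: sumr_ge0.
Qed.

Definition grad_const := Num.sqrt (2 / Qmin Q).

(** The reverse Poincare inequality localised at an edge: test it on densities
    concentrating on the two end points. One end point would not do, as the
    logarithmic mean vanishes when one of its arguments does. *)
Lemma heat_edge_sqr f t b c x y : 0 < t -> x != y -> 0 < Q x y ->
  (forall z, `|f z - c| <= b) ->
  (heat Q t f y - heat Q t f x) ^+ 2 <= b ^+ 2 * (2 / Qmin Q) / t.
Proof.
move=> t0 xy Qxy fb.
set D := heat Q t f y - heat Q t f x; set w := Q x y * pi x.
have w0 : 0 < w by rewrite mulr_gt0.
have b0 : 0 <= b := le_trans (normr_ge0 _) (fb x).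
pose g z := 1 * f z + (- c) * 1.
have hg z : heat Q t g z = heat Q t f z - c.
  by rewrite heat_lin heat_cst mul1r mulr1.
have gb z : g z ^+ 2 <= b ^+ 2.
  rewrite -real_normK ?num_real// ler_sqr ?nnegrE//.
  by rewrite /g mul1r mulr1 fb.
have Deps e : 0 < e -> t * (w * D ^+ 2) <= b ^+ 2 * (pi x + pi y + e).
  move=> e0.
  (* [e] keeps the density positive; it tends to 0 below. *)
  pose rho z : R := e + (z == x)%:R + (z == y)%:R.
  have rho0 z : 0 < rho z by rewrite /rho -addrA ltr_wpDr// addr_ge0 ?ler0n.
  apply: (@le_trans _ _ (t * action rho (heat Q t g))).
    rewrite ler_pM2l// /action.
    have := edge_sum_ge2 (fun x y => theta_log (rho x) (rho y) *
      (heat Q t g y - heat Q t g x) ^+ 2) x y _ xy.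
    have rx : rho x = e + 1 by rewrite /rho eqxx (negPf xy) addr0.
    have ry : rho y = e + 1 by rewrite /rho eqxx eq_sym (negPf xy) addr0.
    rewrite rx ry theta_logxx; last by rewrite addr_gt0.
    have -> : heat Q t g x - heat Q t g y = - D by rewrite !hg /D; ring.
    have -> : heat Q t g y - heat Q t g x = D by rewrite !hg /D; ring.
    rewrite sqrrN => H; apply: (@le_trans _ _ (2^-1 *
        (((e + 1) * D ^+ 2 + (e + 1) * D ^+ 2) * w))).
      rewrite (_ : 2^-1 * _ = w * D ^+ 2 + e * (w * D ^+ 2)); last by field.
      rewrite lerDl; apply: mulr_ge0; first exact: ltW.
      by apply: mulr_ge0; [exact: ltW|exact: sqr_ge0].
    rewrite ler_pM2l ?invr_gt0//; apply: H => u v.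
    by rewrite mulr_ge0 ?sqr_ge0// ltW// theta_log_gt0.
  apply: le_trans (reverse_poincare rho g t (ltW t0) rho0) _.
  apply: (@le_trans _ _ (b ^+ 2 * inner pi (heat Q t rho) (fun=> 1))).
    rewrite /inner mulr_sumr; apply: ler_sum => z _.
    rewrite mulr1 [leRHS]mulrA; apply: ler_wpM2r => //.
    rewrite [leRHS]mulrC; apply: ler_wpM2l; last exact: gb.
    by apply: ltW; exact: heat_gt0 (ltW t0) rho0 z.
  rewrite heat_mass; apply: ler_wpM2l; first exact: sqr_ge0.
  rewrite (_ : inner _ _ _ = pi x + pi y + e)//.
  rewrite /inner /rho; under eq_bigr do rewrite mulr1 mulrC !mulrDr.
  rewrite !big_split /= -mulr_suml (chain_pi_sum hchain) mul1r.
  under [X in _ + X + _]eq_bigr do rewrite eq_sym.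
  under [X in _ + X]eq_bigr do rewrite eq_sym.
  by rewrite !sum_indicator -addrA addrC.
have D1 : t * (w * D ^+ 2) <= b ^+ 2 * (pi x + pi y).
  apply/ler_addgt0Pr => e e0.
  have b1 : 0 < b ^+ 2 + 1 by rewrite ltr_wpDl ?sqr_ge0.
  apply: le_trans (Deps (e / (b ^+ 2 + 1)) _) _; first by rewrite divr_gt0.
  rewrite mulrDr lerD2l mulrA ler_pdivrMr// mulrC ler_pM2l//.
  by rewrite lerDl.
have q0 := Qmin_gt0.
have px : pi x <= w / Qmin Q.
  rewrite ler_pdivlMr// mulrC ler_wpM2r//; apply: Qmin_le.
  by rewrite /Defs.adjacent xy.
have py : pi y <= w / Qmin Q.
  rewrite /w (chain_reversible hchain) ler_pdivlMr// mulrC ler_wpM2r//.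
  by apply: Qmin_le; rewrite /Defs.adjacent eq_sym xy Q_gt0_sym.
rewrite ler_pdivlMr// -(ler_pM2l w0).
rewrite (_ : w * (D ^+ 2 * t) = t * (w * D ^+ 2)); last by ring.
apply: le_trans D1 _; rewrite mulrCA ler_wpM2l ?sqr_ge0//.
apply: le_trans (lerD px py) _; rewrite le_eqVlt; apply/orP; left; apply/eqP.
by field; exact: lt0r_neq0.
Qed.

Lemma heat_edge f t b c x y : 0 < t -> 0 < Q x y -> (forall z, `|f z - c| <= b) ->
  `|heat Q t f y - heat Q t f x| <= b * grad_const / Num.sqrt t.
Proof.
move=> t0 Qxy fb.
have b0 : 0 <= b := le_trans (normr_ge0 _) (fb x).
have [<-|xy] := eqVneq x y.
  by rewrite subrr normr0 divr_ge0 ?sqrtr_ge0// mulr_ge0// sqrtr_ge0.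
rewrite -ler_sqr ?nnegrE//; last by rewrite divr_ge0 ?sqrtr_ge0// mulr_ge0// sqrtr_ge0.
rewrite real_normK ?num_real// /grad_const !exprMn exprVn !sqr_sqrtr.
- exact: heat_edge_sqr t0 xy Qxy fb.
- exact: ltW.
- by rewrite ltW// divr_gt0// Qmin_gt0.
Qed.

Definition variation f := 2^-1 * edge_sum (fun x y => `|f y - f x|).

Lemma variation_ge0 f : 0 <= variation f.
Proof. by rewrite mulr_ge0// edge_sum_ge0. Qed.

(** How fast the heat flow moves a function, in the $L^1$-gradient of that
    function: integrate $-\frac{d}{du}\langle f, P_u f\rangle$, bounded through
    [heat_edge]. The substitution $u = v^2$ removes the singularity of that
    bound at $u = 0$. *)
Lemma smoothing f b c s : 0 <= s -> (forall z, `|f z - c| <= b) ->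
  inner pi f f - inner pi f (heat Q s f) <=
    2 * b * grad_const * variation f * Num.sqrt s.
Proof.
move=> s0 fb.
pose H v := inner pi f (heat Q (v * v) f).
pose dH v := inner pi f (laplacian Q (heat Q (v * v) f)) * (1 * v + v * 1).
have DH (v : R) : is_derive v 1 H (dH v).
  have Dx x := rderive_comp (g := fun v => v * v) (derive_heat f x (v * v))
    (rderive_mul (rderive_id v) (rderive_id v)).
  apply: is_derive_eq (derive_inner _ _ _ _ _
    (fun x => is_derive_cst (f x) v 1) Dx) _.
  rewrite /dH /inner -big_split /= mulr_suml; apply: eq_bigr => x _.
  by rewrite /cst; ring.
have := rderive_growth H dH 0 (Num.sqrt s)
  (- (2 * b * grad_const * variation f)) (sqrtr_ge0 s) (fun v _ => DH v).
rewrite subr0 /H -!expr2 sqr_sqrtr// expr0n /=.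
have -> : inner pi f (heat Q 0 f) = inner pi f f.
  by apply: eq_bigr => x _; rewrite heat0.
rewrite mulNr lerNl opprB; apply => v /andP[v0 _].
have [->|vn0] := eqVneq v 0.
  rewrite /dH !(mulr0, mul0r) addr0 mulr0 oppr_le0.
  have [x|noX] := pickP X; last first.
    by rewrite /variation /edge_sum big_pred0// !mulr0.
  have b0 : 0 <= b := le_trans (normr_ge0 _) (fb x).
  rewrite mulr_ge0 ?variation_ge0// mulr_ge0 ?sqrtr_ge0// mulr_ge0//.
have {v0 vn0} v0 : 0 < v by rewrite lt_neqAle eq_sym vn0.
rewrite /dH green mulr1 mul1r.
set E := edge_sum _; suff EV : `|E| <= 2 * variation f * (b * grad_const / v).
  have Ev : E * v <= 2 * variation f * (b * grad_const).
    by rewrite -ler_pdivlMr// -[leRHS]mulrA; exact: le_trans (ler_norm _) EV.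
  rewrite (_ : - (2^-1 * E) * (v + v) = - (E * v)); last by field.
  rewrite lerN2; apply: le_trans Ev _.
  by rewrite le_eqVlt; apply/orP; left; apply/eqP; ring.
apply: (@le_trans _ _ (edge_sum (fun x y => b * grad_const / v * `|f y - f x|))); last first.
  by rewrite edge_sumZ /variation mulrA divff// mul1r mulrC.
apply: le_trans (ler_norm_sum _ _ _) _; apply: ler_sum => x _.
apply: le_trans (ler_norm_sum _ _ _) _; apply: ler_sum => y _.
rewrite normrM (ger0_norm (edge_ge0 x y)).
have [Qxy|Qxy] := ltP 0 (Q x y); last first.
  by have -> : Q x y = 0; [apply/eqP; rewrite eq_le Qxy /=|rewrite mul0r !mulr0].
apply: ler_wpM2r; first exact: edge_ge0.
rewrite normrM mulrC; apply: ler_wpM2r => //.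
have := heat_edge f (v * v) b c x y (mulr_gt0 v0 v0) Qxy fb.
by rewrite -expr2 sqrtr_sqr (gtr0_norm v0).
Qed.

(** * Poincare inequality *)

Lemma inner_ge0 f : 0 <= inner pi f f.
Proof. by apply: sumr_ge0 => x _; rewrite mulr_ge0// -expr2 sqr_ge0. Qed.

Lemma inner_eq0 f : inner pi f f = 0 -> forall x, f x = 0.
Proof.
move=> /eqP; rewrite psumr_eq0; last first.
  by move=> x _; rewrite mulr_ge0// -expr2 sqr_ge0.
move=> /allP f0 x; have := f0 x (mem_index_enum x).
by rewrite /= -expr2 mulf_eq0 sqrf_eq0 (gt_eqF (pi_gt0 x)) orbF => /eqP.
Qed.

Lemma inner_linl a b f g h :
  inner pi (fun x => a * f x + b * g x) h = a * inner pi f h + b * inner pi g h.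
Proof.
rewrite /inner !mulr_sumr -big_split; apply: eq_bigr => x _ /=; ring.
Qed.

Lemma inner_linr a b f g h :
  inner pi h (fun x => a * f x + b * g x) = a * inner pi h f + b * inner pi h g.
Proof. by rewrite innerC inner_linl !(innerC h). Qed.

Lemma inner_cst f c : inner pi f (fun=> c) = c * inner pi f (fun=> 1).
Proof. by rewrite /inner mulr_sumr; apply: eq_bigr => x _; ring. Qed.

Lemma inner11 : inner pi (fun=> 1) (fun=> 1) = 1.
Proof. by rewrite -[RHS](chain_pi_sum hchain); apply: eq_bigr => x _; rewrite !mul1r. Qed.

Definition dirichlet f := - inner pi f (laplacian Q f).

Lemma laplacian_lin a b f g x : laplacian Q (fun z => a * f z + b * g z) x =
  a * laplacian Q f x + b * laplacian Q g x.
Proof.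
rewrite /laplacian !mulr_sumr -big_split; apply: eq_bigr => y _ /=; ring.
Qed.

Lemma laplacian_mean0 f : inner pi (laplacian Q f) (fun=> 1) = 0.
Proof.
rewrite laplacian_sym /inner big1// => x _.
by rewrite /laplacian big1 ?mulr0 ?mul0r// => y _; rewrite subrr mul0r.
Qed.

Lemma dirichlet_lin a b f g : dirichlet (fun z => a * f z + b * g z) =
  a ^+ 2 * dirichlet f + 2 * a * b * - inner pi g (laplacian Q f) +
  b ^+ 2 * dirichlet g.
Proof.
rewrite /dirichlet.
have -> : laplacian Q (fun z => a * f z + b * g z) =
    (fun x => a * laplacian Q f x + b * laplacian Q g x).
  by apply/funext => x; exact: laplacian_lin.
rewrite inner_linl !inner_linr -[inner pi f (laplacian Q g)]laplacian_sym.
rewrite [inner pi (laplacian Q f) g]innerC; ring.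
Qed.

Lemma dirichlet_ge0 f : 0 <= dirichlet f.
Proof.
rewrite /dirichlet green opprK mulr_ge0// edge_sum_ge0// => x y.
by rewrite -expr2 sqr_ge0.
Qed.

(** A function without energy is constant along edges, and the chain is
    irreducible. *)
Lemma dirichlet_eq0 f : dirichlet f = 0 -> forall x y, f x = f y.
Proof.
rewrite /dirichlet green opprK => /eqP.
rewrite mulf_eq0 invr_eq0 (negPf (_ : 2 != 0 :> R))//= => /eqP E0.
have fe x y : 0 < Q x y -> f x = f y.
  move=> Qxy; have [->//|xy] := eqVneq x y.
  have F0 u v : 0 <= (f v - f u) * (f v - f u) by rewrite -expr2 sqr_ge0.
  have := edge_sum_ge2 _ x y F0 xy.
  rewrite E0 pmulr_lle0 ?mulr_gt0// -[f x - f y]opprB mulrNN -expr2 => h.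
  have : (f y - f x) ^+ 2 = 0 by have := sqr_ge0 (f y - f x); lra.
  by move=> /eqP; rewrite sqrf_eq0 subr_eq0 => /eqP.
move=> x y; have /connectP[p] := chain_irreducible hchain x y.
elim: p x => [x _ ->//|z p IH x /= /andP[xz zp] yl].
by rewrite (fe x z xz); exact: IH.
Qed.

(** First-order optimality condition for a quadratic polynomial with a minimum
    at 0. *)
Lemma quadratic_ge0_linear0 (N C : R) : 0 <= N -> 0 <= C ->
  (forall e, 0 <= 2 * e * N + e ^+ 2 * C) -> N = 0.
Proof.
move=> N0 C0 H; have C1 : 0 < C + 1 by lra.
(* Nearly the minimiser; the shift by 1 allows [C = 0]. *)
have := H (- (N / (C + 1))); set q := N / (C + 1).
have -> : N = q * (C + 1) by rewrite /q divfK ?gt_eqF.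
have q0 : 0 <= q by rewrite divr_ge0// ltW.
move=> h; have q2 : q ^+ 2 * (C + 2) <= 0 by lra.
have : q ^+ 2 <= 0 by rewrite -(pmulr_lle0 _ (_ : 0 < C + 2))//; lra.
move=> q20; have : q ^+ 2 = 0 by have := sqr_ge0 q; lra.
by move=> /eqP; rewrite sqrf_eq0 => /eqP ->; rewrite mul0r.
Qed.

Variable lambda1 : R.
Hypothesis hlambda1 : smallest_positive_eigenvalue Q lambda1.

Let lambda1_gt0 : 0 < lambda1. Proof. by case: hlambda1. Qed.

(** A minimiser of the Rayleigh quotient exists by compactness of the unit
    sphere. *)
Lemma rayleigh_minimiser : exists h, [/\ inner pi h h = 1,
  inner pi h (fun=> 1) = 0 & forall g, inner pi g (fun=> 1) = 0 ->
    dirichlet h * inner pi g g <= dirichlet g].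
Proof.
pose fv (v : 'rV[R]_#|X|) x := v ord0 (enum_rank x).
pose A := [set v | inner pi (fv v) (fv v) = 1 /\ inner pi (fv v) (fun=> 1) = 0]%classic.
have row_fv f : exists v, fv v = f.
  exists (\row_i f (enum_val i)); apply/funext => x.
  by rewrite /fv mxE enum_rankK.
have normalise g : inner pi g (fun=> 1) = 0 -> inner pi g g != 0 ->
    exists v, A v /\ fv v = (fun x => (Num.sqrt (inner pi g g))^-1 * g x + 0 * g x).
  move=> g1 gg.
  have [v vE] := row_fv (fun x => (Num.sqrt (inner pi g g))^-1 * g x + 0 * g x).
  exists v; split => //; rewrite /A /= vE; split.
    rewrite inner_linl !inner_linr !mul0r !addr0 mulrA -expr2 exprVn.
    by rewrite sqr_sqrtr ?inner_ge0// mulVf.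
  by rewrite inner_linl g1 !mulr0 addr0.
have fv_cont x : continuous (fun v => fv v x).
  by move=> v; exact: coord_continuous.
have sum_cont (F : X -> 'rV[R]_#|X| -> R) : (forall x, continuous (F x)) ->
    continuous (fun v => \sum_x F x v).
  by move=> Fc; apply: continuous_big => // x; exact: add_continuous.
have inner_cont (F G : X -> 'rV[R]_#|X| -> R) : (forall x, continuous (F x)) ->
    (forall x, continuous (G x)) ->
    continuous (fun v => inner pi (fun x => F x v) (fun x => G x v)).
  move=> Fc Gc; apply: (sum_cont (fun x v => F x v * G x v * pi x)) => x v.
  exact: (cvgM (cvgM (Fc x v) (Gc x v)) (cvg_cst _)).
have cA : compact A.
  apply: bounded_closed_compact.
    exists (\sum_x (pi x)^-1 + 1); split; first exact: num_real.
    move=> M MM v [v1 _]; rewrite /= [leLHS]/Num.norm /= mx_normrE; apply/bigmax_leP.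
    have pi_inv x : (pi x)^-1 <= \sum_x (pi x)^-1.
      by rewrite (bigD1 x)//= lerDl sumr_ge0// => y _; rewrite invr_ge0.
    split=> [|[i j] _ /=].
      apply: le_trans (ltW MM); rewrite addr_ge0// sumr_ge0// => y _.
      by rewrite invr_ge0.
    apply: le_trans (ltW MM); rewrite ord1 -[j]enum_valK -/(fv v (enum_val j)).
    have sq : fv v (enum_val j) ^+ 2 <= (pi (enum_val j))^-1.
      rewrite -div1r ler_pdivlMr// expr2 -[leRHS]v1 /inner (bigD1 (enum_val j))//=.
      by rewrite lerDl sumr_ge0// => x _; rewrite mulr_ge0// -expr2 sqr_ge0.
    have := pi_inv (enum_val j); move: sq; move: (fv v _) => z.
    move=> sq le; have sq' : z ^+ 2 <= \sum_x (pi x)^-1 by lra.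
    by rewrite -[X in X ^+ 2]/z -real_normK ?num_real// in sq'; nra.
  pose n2 v := inner pi (fv v) (fv v); pose mean v := inner pi (fv v) (fun=> 1).
  have -> : A = (n2 @^-1` [set y | y = 1] `&` mean @^-1` [set y | y = 0])%classic.
    by apply/seteqP; split => v.
  apply: closedI; apply: preimage_closed; try exact: closed_eq.
    by move=> v _; exact: (inner_cont (fun x v => fv v x) (fun x v => fv v x)).
  move=> v _; apply: (inner_cont (fun x v => fv v x) (fun _ _ => 1) fv_cont) => x.
  exact: cst_continuous.
have [f [x0 fx0] fE] : exists2 f : X -> R, (exists x, f x != 0) &
  forall x, - laplacian Q f x = lambda1 * f x by case: hlambda1.
have f1 : inner pi f (fun=> 1) = 0.
  apply: (mulfI (lt0r_neq0 lambda1_gt0)); rewrite mulr0.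
  transitivity (- inner pi (laplacian Q f) (fun=> 1)); last first.
    by rewrite laplacian_mean0 oppr0.
  rewrite /inner mulr_sumr -sumrN; apply: eq_bigr => x _.
  by rewrite mulrA mulrA -fE; ring.
have ff : inner pi f f != 0.
  by apply: contra fx0 => /eqP /inner_eq0 ->.
have [v0 [Av0 _]] := normalise f f1 ff.
have Ec : continuous (fun v => dirichlet (fv v)).
  have lap_cont x : continuous (fun v => laplacian Q (fv v) x).
    apply: (sum_cont (fun y v => (fv v y - fv v x) * Q x y)) => y u.
    exact: (cvgM (cvgB (fv_cont y u) (fv_cont x u)) (cvg_cst _)).
  have ic := inner_cont _ (fun x v => laplacian Q (fv v) x) fv_cont lap_cont.
  by move=> v; exact: (cvgN (ic v)).
have [v vA vmin] := @compact_EVT_min _ R (fun v => dirichlet (fv v)) A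
  (ex_intro _ v0 Av0) cA (continuous_subspaceT Ec).
rewrite inE in vA; case: (vA) => v1 v2.
exists (fv v); split => // g g1.
have [gg|gg] := eqVneq (inner pi g g) 0.
  by rewrite gg mulr0 dirichlet_ge0.
have [w [Aw wE]] := normalise g g1 gg.
have := vmin w (mem_set Aw); rewrite wE dirichlet_lin.
rewrite expr0n !mul0r !mulr0 mul0r !addr0 exprVn sqr_sqrtr ?inner_ge0//.
by rewrite mulrC ler_pdivlMr// lt_neqAle eq_sym gg inner_ge0.
Qed.

(** Poincare inequality: the first variation of the Rayleigh quotient shows that
    its minimum over mean zero functions is a positive eigenvalue of the
    Laplacian, hence at least [lambda1]. *)
Lemma poincare g : inner pi g (fun=> 1) = 0 ->
  lambda1 * inner pi g g <= dirichlet g.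
Proof.
have [h [h1 h0 hmin]] := rayleigh_minimiser.
pose mu := dirichlet h.
pose w x := - 1 * laplacian Q h x + - mu * h x.
have w1 : inner pi w (fun=> 1) = 0.
  by rewrite inner_linl laplacian_mean0 h0 !mulr0 addr0.
have wh : inner pi w h = 0.
  rewrite inner_linl h1 mulr1 innerC mulN1r -/(dirichlet h); exact: subrr.
have ww : inner pi w (laplacian Q h) = - inner pi w w.
  have -> : inner pi w w = - 1 * inner pi w (laplacian Q h) + - mu * inner pi w h.
    exact: inner_linr.
  by rewrite wh; ring.
have wE x : w x = - 1 * laplacian Q h x + - mu * h x by [].
clearbody w.
have w0 : inner pi w w = 0.
  apply: (@quadratic_ge0_linear0 _ (dirichlet w - mu * inner pi w w)).
  - exact: inner_ge0.
  - by rewrite subr_ge0; exact: hmin.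
  move=> e; have := hmin (fun x => 1 * h x + e * w x).
  rewrite [X in X = 0 -> _]inner_linl h0 w1 !mulr0 addr0 => /(_ erefl).
  rewrite dirichlet_lin inner_linl !inner_linr h1 (innerC h) wh ww -/mu.
  by rewrite -subr_ge0; congr (0 <= _); ring.
have hE x : - laplacian Q h x = mu * h x.
  by have := inner_eq0 w w0 x; rewrite wE; lra.
have mu0 : 0 < mu.
  rewrite lt_neqAle dirichlet_ge0 andbT eq_sym; apply/eqP => mu0.
  have hc := dirichlet_eq0 h mu0.
  have hx x : h x = 0.
    rewrite -h0; transitivity (inner pi (fun=> 1) (fun=> h x)).
      by rewrite inner_cst inner11 mulr1.
    by rewrite innerC; apply: eq_bigr => y _; rewrite (hc x y).
  move: h1; rewrite /inner big1; last by move=> x _; rewrite hx !mul0r.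
  by move=> /esym/eqP; rewrite oner_eq0.
have lmu : lambda1 <= mu.
  case: hlambda1 => _ _; apply => //; exists h => //.
  apply: contrapT => nh; move: h1; rewrite /inner big1.
    by move=> /esym/eqP; rewrite oner_eq0.
  move=> x _; have -> : h x = 0; last by rewrite !mul0r.
  by apply/eqP/negPn/negP => hx; apply: nh; exists x.
move=> g1; apply: le_trans (hmin g g1).
by rewrite ler_wpM2r// inner_ge0.
Qed.

(** The left-hand side is $\|P_{s/2}f\|^2$, and the Poincare inequality makes
    $e^{2\lambda_1u}\|P_uf\|^2$ nonincreasing in $u$. *)
Lemma heat_decay f s : 0 <= s -> inner pi f (fun=> 1) = 0 ->
  inner pi f (heat Q s f) <= expR (- (lambda1 * s)) * inner pi f f.
Proof.
move=> s0 f0; rewrite -(heat_pairing (s / 2) s).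
rewrite (_ : s - s / 2 = s / 2); last by field.
pose N u := expR (2 * lambda1 * u) * - inner pi (heat Q u f) (heat Q u f).
pose dN u := expR (2 * lambda1 * u) *
  (2 * (dirichlet (heat Q u f) - lambda1 * inner pi (heat Q u f) (heat Q u f))).
have DN (u : R) : is_derive u 1 N (dN u).
  have Di := derive_inner _ _ _ _ _ (fun x => derive_heat f x u)
    (fun x => derive_heat f x u).
  apply: is_derive_eq (rderive_mul (rderive_comp (is_derive_expR (2 * lambda1 * u))
    (rderive_mull (2 * lambda1) (rderive_id u))) (rderive_opp Di)) _.
  by rewrite laplacian_sym /dN /dirichlet; ring.
have s20 : 0 <= s / 2 by rewrite divr_ge0.
have := rderive_growth N dN 0 (s / 2) 0 s20 (fun u _ => DN u).
rewrite mul0r subr_ge0 /N mulr0 expR0 mul1r mulrN lerN2.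
rewrite (_ : 2 * lambda1 * (s / 2) = lambda1 * s); last by field.
have -> : inner pi (heat Q 0 f) (heat Q 0 f) = inner pi f f.
  by apply: eq_bigr => x _; rewrite heat0.
rewrite expRN ler_pdivlMl ?expR_gt0//; apply => u /andP[u0 _].
rewrite mulr_ge0 ?expR_ge0// mulr_ge0// subr_ge0; apply: poincare.
by rewrite heat_mass.
Qed.

(** * An isoperimetric inequality *)

Definition deviation f := \sum_x `|f x - inner pi f (fun=> 1)| * pi x.

Definition indicator (A : {set X}) : X -> R := fun x => (x \in A)%:R.

Lemma deviation_triangle a f g : 0 <= a ->
  deviation (fun x => a * f x + 1 * g x) <= a * deviation f + deviation g.
Proof.
move=> a0; rewrite /deviation mulr_sumr -big_split; apply: ler_sum => x _ /=.
rewrite inner_linl mulrA -mulrDl; apply: ler_wpM2r => //.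
rewrite -[X in X * `|_|]ger0_norm// -normrM.
apply: le_trans (ler_normD _ _); rewrite le_eqVlt; apply/orP; left.
by apply/eqP; congr `|_|; ring.
Qed.

(** Co-area principle: a nonnegative function is a nonnegative combination of
    indicators of nested sets, and the variation is additive along such a
    decomposition; subtracting the smallest positive value times the indicator
    of the support removes one layer. *)
Lemma deviation_le_variation K :
  0 <= K -> (forall A, deviation (indicator A) <= K * variation (indicator A)) ->
  forall f, (forall x, 0 <= f x) -> deviation f <= K * variation f.
Proof.
move=> K0 KA f; move: {2}#|_| (leqnn #|[set x | f x != 0]|) => n.
elim: n f => [|n IH] f fn f0.
  have fz x : f x = 0.
    apply/eqP/negPn/negP => fx; move: fn; rewrite leqn0 cards_eq0 => /eqP/setP/(_ x).
    by rewrite !inE fx.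
  have -> : deviation f = 0; last by apply: mulr_ge0 => //; exact: variation_ge0.
  rewrite /deviation big1// => x _.
  rewrite fz /inner big1 ?subr0 ?normr0 ?mul0r// => y _.
  by rewrite fz !mul0r.
have [fz|/finset.set0Pn[x1]] := eqVneq [set x | f x != 0] finset.set0.
  by apply: IH => //; rewrite fz cards0.
pose A := [set x | f x != 0]; rewrite -/A => x1A.
have memA x : (x \in A) = (f x != 0) by rewrite inE.
have [x0 x0A x0min] := @arg_minP _ _ _ x1 (fun x => x \in A) f x1A.
set m := f x0 in x0min.
have m0 : 0 < m.
  by move: x0A; rewrite memA lt_neqAle eq_sym f0 andbT.
pose g x := f x - m * indicator A x.
have gA x : x \in A -> g x = f x - m by move=> xA; rewrite /g /indicator xA mulr1.
have gNA x : x \notin A -> g x = 0.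
  move=> xA; rewrite /g /indicator (negPf xA) mulr0 subr0.
  by move: xA; rewrite memA negbK => /eqP.
have g0 x : 0 <= g x.
  by have [xA|xA] := boolP (x \in A); [rewrite gA// subr_ge0 x0min|rewrite gNA].
have gn : (#|[set x | g x != 0%R]| <= n)%N.
  rewrite -ltnS; apply: leq_trans fn; apply: proper_card.
  apply/properP; split; last first.
    by exists x0 => //; rewrite inE gA// subrr eqxx.
  by apply/fintype.subsetP => x; rewrite inE; apply: contraR => /gNA ->.
have fE : f = (fun x => m * indicator A x + 1 * g x).
  by apply/funext => x; rewrite /g; ring.
have vE : variation f = m * variation (indicator A) + variation g.
  rewrite /variation [in RHS]mulrCA -mulrDr; congr (_ * _).
  rewrite -edge_sumZ -edge_sumD; apply: eq_edge_sum => x y.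
  have [xA|xA] := boolP (x \in A); have [yA|yA] := boolP (y \in A).
  - rewrite !gA// /indicator xA yA subrr normr0 mulr0 add0r; congr `|_|; ring.
  - have fy : f y = 0 by move: yA; rewrite memA negbK => /eqP.
    rewrite (gA x)// (gNA y)// /indicator xA (negPf yA) fy !sub0r !normrN normr1 mulr1.
    have := x0min x xA => mf.
    rewrite [`|f x|]ger0_norm ?f0// [`|f x - m|]ger0_norm ?subr_ge0//; ring.
  - have fx : f x = 0 by move: xA; rewrite memA negbK => /eqP.
    rewrite (gA y)// (gNA x)// /indicator yA (negPf xA) fx !subr0 normr1 mulr1.
    have := x0min y yA => mf.
    rewrite [`|f y|]ger0_norm ?f0// [`|f y - m|]ger0_norm ?subr_ge0//; ring.
  - have fx : f x = 0 by move: xA; rewrite memA negbK => /eqP.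
    have fy : f y = 0 by move: yA; rewrite memA negbK => /eqP.
    by rewrite !gNA// /indicator (negPf xA) (negPf yA) fx fy !subr0 normr0; ring.
rewrite vE fE; apply: le_trans (deviation_triangle _ _ _ (ltW m0)) _.
rewrite mulrDr mulrCA; apply: lerD; last exact: IH.
by apply: ler_wpM2l; [exact: ltW|exact: KA].
Qed.

Definition dev_const := 4 * grad_const * Num.sqrt (ln 2 / lambda1).

(** Cheeger-type inequality (Buser, Ledoux). At time $s = \ln 2/\lambda_1$ the
    spectral gap has halved the variance of the indicator, while [smoothing]
    limits that loss by the boundary measure of the set. *)
Lemma deviation_indicator A :
  deviation (indicator A) <= dev_const * variation (indicator A).
Proof.
set a := inner pi (indicator A) (fun=> 1).
pose f x := 1 * indicator A x + - a * 1.
have ind_sq x : indicator A x * indicator A x = indicator A x.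
  by rewrite /indicator; case: (x \in A); rewrite ?mulr1 ?mulr0.
have ind01 x : indicator A x = 0 \/ indicator A x = 1.
  by rewrite /indicator; case: (x \in A); [right|left].
have aE : inner pi (indicator A) (indicator A) = a.
  by apply: eq_bigr => x _; rewrite ind_sq mulr1.
have a0 : 0 <= a by rewrite -aE inner_ge0.
have a1 : a <= 1.
  rewrite -inner11; apply: ler_sum => x _; rewrite !mulr1; apply: ler_wpM2r => //.
  by case: (ind01 x) => ->.
have f0 : inner pi f (fun=> 1) = 0.
  by rewrite inner_linl inner11 -/a; ring.
have ff : inner pi f f = a * (1 - a).
  rewrite /f inner_linl !inner_linr aE inner11 [inner pi (fun=> 1) _]innerC -/a; ring.
have devE : deviation (indicator A) = 2 * inner pi f f.
  transitivity (inner pi (fun x => (1 - 2 * a) * indicator A x + a * 1) (fun=> 1)).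
    apply: eq_bigr => x _; rewrite -/a mulr1; congr (_ * _).
    case: (ind01 x) => ->.
      by rewrite sub0r normrN ger0_norm//; ring.
    by rewrite ger0_norm ?subr_ge0//; ring.
  by rewrite inner_linl inner11 -/a ff; ring.
have vE : variation f = variation (indicator A).
  congr (_ * _); apply: eq_edge_sum => x y; congr `|_|.
  by rewrite /f; ring.
have s0 : 0 <= ln 2 / lambda1 by rewrite divr_ge0 ?ltW// ln_gt0// ltr1n.
(* The values of [f] are [- a] and [1 - a]: centred, its sup norm is 1/2. *)
have fb z : `|f z - (2^-1 - a)| <= 2^-1.
  rewrite /f; case: (ind01 z) => ->.
    by rewrite (_ : _ - _ = - 2^-1); [rewrite normrN ger0_norm|field].
  by rewrite (_ : _ - _ = 2^-1); [rewrite ger0_norm|field].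
have sm := smoothing f 2^-1 (2^-1 - a) (ln 2 / lambda1) s0 fb.
have dc := heat_decay f (ln 2 / lambda1) s0 f0.
have l0 : lambda1 != 0 by rewrite lt0r_neq0.
rewrite (_ : lambda1 * _ = ln 2) in dc; last by field.
rewrite expRN lnK ?posrE// in dc.
rewrite devE -vE /dev_const.
move: sm dc; set I := inner pi f f; set J := inner pi f _.
set r := Num.sqrt _; set k := grad_const; set v := variation f.
rewrite divff// mul1r => sm dc.
rewrite (_ : 4 * k * r * v = 4 * (k * v * r)); [lra|ring].
Qed.

(** * Average mixing *)

(** By duality with the signs of the differences, [heat_edge] bounds the mean
    variation of the heat kernel in its second variable. *)
Lemma variation_heat_kernel t : 0 < t ->
  \sum_x pi x * variation (heat_kernel Q pi t x) <= 2^-1 * (grad_const / Num.sqrt t).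
Proof.
move=> t0.
have -> : \sum_x pi x * variation (heat_kernel Q pi t x) =
    2^-1 * edge_sum (fun y z => \sum_x
      `|heat Q t (fun w => (w == x)%:R) z - heat Q t (fun w => (w == x)%:R) y|).
  under eq_bigr do rewrite /variation mulrCA.
  rewrite -mulr_sumr; congr (_ * _); rewrite /edge_sum.
  under [RHS]eq_bigr => y _ do under eq_bigr => z _ do rewrite mulr_suml.
  under [RHS]eq_bigr => y _ do rewrite exchange_big /=.
  rewrite [RHS]exchange_big /=; apply: eq_bigr => x _.
  rewrite mulr_sumr; apply: eq_bigr => y _.
  rewrite mulr_sumr; apply: eq_bigr => z _.
  rewrite [LHS]mulrA; congr (_ * _); rewrite /heat_kernel -mulrBr normrM.
  by rewrite ger0_norm ?invr_ge0// mulrA mulfV ?mul1r// lt0r_neq0.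
rewrite ler_pM2l ?invr_gt0//.
apply: (@le_trans _ _ (edge_sum (fun _ _ => grad_const / Num.sqrt t * 1))).
  apply: ler_edge_sum => y z Qyz.
  pose h x u := heat Q t (fun w => (w == x)%:R) u.
  pose e x : R := Num.sg (h x z - h x y).
  have -> : \sum_x `|h x z - h x y| = heat Q t e z - heat Q t e y.
    rewrite (heat_indicator t e z) (heat_indicator t e y) -sumrB.
    by apply: eq_bigr => x _; rewrite -mulrBr -normrEsg.
  apply: le_trans (ler_norm _) _; rewrite mulr1 -[X in X / _]mul1r.
  apply: (heat_edge e t 1 0) => // x; rewrite subr0 normr_sg.
  by case: (_ != 0).
rewrite edge_sumZ /edge_sum.
under eq_bigr do (under eq_bigr do rewrite mul1r;
  rewrite -mulr_suml (chain_Q_sum hchain) mul1r).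
by rewrite (chain_pi_sum hchain) mulr1.
Qed.

Lemma heat_kernel_deviation t : 0 < t ->
  \sum_x \sum_y pi x * pi y * `|heat_kernel Q pi t x y - 1| <=
  dev_const * (2^-1 * (grad_const / Num.sqrt t)).
Proof.
move=> t0.
have K0 : 0 <= dev_const by rewrite !mulr_ge0 ?sqrtr_ge0.
apply: le_trans (ler_wpM2l K0 (variation_heat_kernel t t0)).
rewrite mulr_sumr; apply: ler_sum => x _; rewrite mulrCA.
have -> : \sum_y pi x * pi y * `|heat_kernel Q pi t x y - 1| =
    pi x * deviation (heat_kernel Q pi t x).
  rewrite /deviation mulr_sumr; apply: eq_bigr => y _.
  rewrite (_ : inner _ _ _ = 1); first by rewrite -mulrA [pi y * _]mulrC.
  transitivity ((pi x)^-1 * inner pi (heat Q t (fun z => (z == x)%:R)) (fun=> 1)).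
    by rewrite /inner mulr_sumr; apply: eq_bigr => z _; rewrite /heat_kernel !mulrA.
  by rewrite heat_mass innerC inner_indicator mul1r mulVf// lt0r_neq0.
apply: ler_wpM2l => //; apply: deviation_le_variation => // [A|y].
  exact: deviation_indicator.
by rewrite mulr_ge0 ?invr_ge0// heat_ge0 ?ltW// => z; rewrite ler0n.
Qed.

(** The time is chosen so that the bound of [heat_kernel_deviation] is exactly
    $1/4$. *)
Lemma mixing_bound t : t = 256 * ln 2 / (lambda1 * Qmin Q ^+ 2) ->
  0 < t /\ \sum_x \sum_y pi x * pi y * `|heat_kernel Q pi t x y - 1| <= 1 / 4.
Proof.
move=> tE; have q0 := Qmin_gt0; have l0 := lambda1_gt0.
have ln20 : 0 < ln 2 :> R by rewrite ln_gt0// ltr1n.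
have t0 : 0 < t by rewrite tE divr_gt0 ?mulr_gt0 ?exprn_gt0.
split=> //; apply: le_trans (heat_kernel_deviation t t0) _.
set s := ln 2 / lambda1.
have s0 : 0 < s by rewrite divr_gt0.
have -> : t = s * (16 / Qmin Q) ^+ 2.
  by rewrite tE /s; field; rewrite !lt0r_neq0.
rewrite sqrtrM ?(ltW s0)// sqrtr_sqr ger0_norm ?divr_ge0 ?(ltW q0)//.
have gg : grad_const * grad_const = 2 / Qmin Q.
  by rewrite -expr2 sqr_sqrtr// divr_ge0// ltW.
rewrite /dev_const -/s.
have r0 : 0 < Num.sqrt s by rewrite sqrtr_gt0.
rewrite (_ : _ * _ = grad_const * grad_const * Qmin Q / 8).
  rewrite gg le_eqVlt; apply/orP; left; apply/eqP; field.
  exact: lt0r_neq0.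
by field; rewrite !lt0r_neq0.
Qed.

End Chain.

Theorem theorem7p6 (R : realType) (X : finType) (Q : X -> X -> R)
    (pi : X -> R) (lambda1 : R)
    (hchain : markov_chain Q pi)
    (hCD : CD_ent_0_oo Q pi)
    (hlambda1 : smallest_positive_eigenvalue Q lambda1) :
  (lambda1%:E * tau_avg Q pi (1 / 4) <= (256 * ln 2 / (Qmin Q) ^+ 2)%:E)%E.
Proof.
have l0 : 0 < lambda1 by case: hlambda1.
have q0 := Qmin_gt0 Q.
have [t0 tmix] := mixing_bound Q pi hchain hCD lambda1 hlambda1 _ erefl.
set t := 256 * ln 2 / (lambda1 * Qmin Q ^+ 2) in t0 tmix.
have -> : 256 * ln 2 / Qmin Q ^+ 2 = lambda1 * t.
  by rewrite /t; field; rewrite !lt0r_neq0.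
rewrite EFinM; apply: lee_wpmul2l; first by rewrite lee_fin ltW.
by apply: ereal_inf_lbound; exists t.
Qed.
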